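(* Let $\alpha\in(0,2]$ and $\alpha'\in(0,1]$. Let $L_{\alpha\alpha'}$ be a random variable with the Linnik distribution with parameter $\alpha\alpha'$, and let $S_{\alpha,0}$ and $M_{\alpha'}$ be independent random variables, where $S_{\alpha,0}$ has the symmetric strictly stable distribution with characteristic exponent $\alpha$ and $M_{\alpha'}$ has the Mittag-Leffler distribution with parameter $\alpha'$. Then $$L_{\alpha\alpha'}\stackrel{d}{=} S_{\alpha,0}\,M_{\alpha'}^{1/\alpha}.$$
   Context: The symbol $\stackrel{d}{=}$ denotes equality of distributions. Linnik distribution with parameter $\beta\in(0,2]$: the probability distribution on $\mathbb{R}$ with characteristic function $t\mapsto \frac{1}{1+|t|^{\beta}}$, $t\in\mathbb{R}$; $L_\beta$ denotes a random variable with this distribution. Mittag-Leffler distribution with parameter $\delta\in(0,1]$: the distribution of a nonnegative random variable $M_\delta$ with Laplace transform $\mathsf{E}e^{-sM_\delta}=\frac{1}{1+s^{\delta}}$, $s\ge 0$. Symmetric strictly stable distribution with characteristic exponent $\alpha\in(0,2]$: the distribution on $\mathbb{R}$ with characteristic function $t\mapsto e^{-|t|^{\alpha}}$, $t\in\mathbb{R}$; $S_{\alpha,0}$ denotes a random variable with this distribution. *)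

(* Defs.v *)
From HB Require Import structures.
From mathcomp Require Import all_boot all_order all_algebra.
From mathcomp Require Import complex.
From mathcomp Require Import all_classical all_reals all_analysis.
From mathcomp Require Import measurable_realfun.

Set Implicit Arguments.
Unset Strict Implicit.
Unset Printing Implicit Defensive.

Import Order.TTheory GRing.Theory Num.Theory.
Import numFieldNormedType.Exports.

Local Open Scope classical_set_scope.
Local Open Scope ring_scope.

(* The laws below are characterized by an integral transform. The predicates
   make sense as written for all exponents; the admissible ranges (0, 2] and
   (0, 1] are hypotheses of the results that use them. *)

Section laws.
Context {d : measure_display} {T : measurableType d} {R : realType}.
Variable P : probability T R.
Implicit Types X : {RV P >-> R}.

(* E e^{itX} in R[i]. Both integrands are bounded, so the expectations are
   finite and [fine] loses nothing. *)
Definition char_fun X (t : R) : R[i] :=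
  Complex (fine 'E_P[fun w => cos (t * X w)]%E)
          (fine 'E_P[fun w => sin (t * X w)]%E).

Definition linnik (beta : R) X : Prop :=
  forall t : R, char_fun X t = ((1 + `|t| `^ beta)^-1)%:C%C.

Definition symmetric_stable (alpha : R) X : Prop :=
  forall t : R, char_fun X t = (expR (- (`|t| `^ alpha)))%:C%C.

(* Nonnegativity is required almost surely: it is a property of the law. *)
Definition mittag_leffler (delta : R) X : Prop :=
  P [set w | X w < 0] = 0%E /\
  forall s : R, 0 <= s ->
    'E_P[fun w => expR (- (s * X w))]%E = ((1 + s `^ delta)^-1)%:E.

End laws.

Definition independent_RV {d : measure_display} {T : measurableType d}
    {R : realType} (P : probability T R) (X Y : {RV P >-> R}) : Prop :=
  forall A B : set R, measurable A -> measurable B ->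
    P (X @^-1` A `&` Y @^-1` B) = (P (X @^-1` A) * P (Y @^-1` B))%E.

(* Measures are functions on all of [set R] with unspecified values outside the
   sigma-algebra, so laws are compared on Borel sets only. *)
Definition eq_in_distribution {d1 d2 : measure_display}
    {T1 : measurableType d1} {T2 : measurableType d2} {R : realType}
    (P1 : probability T1 R) (P2 : probability T2 R)
    (X : {RV P1 >-> R}) (Y : {RV P2 >-> R}) : Prop :=
  forall A : set R, measurable A -> distribution P1 X A = distribution P2 Y A.

Section operations.
Context {d : measure_display} {T : measurableType d} {R : realType}.
Variable P : probability T R.
Implicit Types X Y : {RV P >-> R}.

Definition mul_RV X Y (w : T) : R := X w * Y w.

Let measurable_mul_RV X Y : measurable_fun [set: T] (mul_RV X Y).
Proof. by apply: measurable_funM; exact: measurable_funP. Qed.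

HB.instance Definition _ X Y :=
  isMeasurableFun.Build _ _ _ _ (mul_RV X Y) (measurable_mul_RV X Y).

Definition powR_RV X (p : R) (w : T) : R := X w `^ p.

Let measurable_powR_RV X p : measurable_fun [set: T] (powR_RV X p).
Proof.
by apply: (measurableT_comp (measurable_powR p)); exact: measurable_funP.
Qed.

HB.instance Definition _ X p :=
  isMeasurableFun.Build _ _ _ _ (powR_RV X p) (measurable_powR_RV X p).

End operations.

Arguments char_fun {d T R} P X t.
Arguments linnik {d T R} P beta X.
Arguments symmetric_stable {d T R} P alpha X.
Arguments mittag_leffler {d T R} P delta X.
Arguments independent_RV {d T R} P X Y.
Arguments eq_in_distribution {d1 d2 T1 T2 R} P1 P2 X Y.
Arguments mul_RV {d T R} P X Y w.
Arguments powR_RV {d T R} P X p w.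

(* Main.v *)
(* Conditioning on M, the characteristic function of S M^(1/alpha) at t is
   E exp(- |t|^alpha M), the Laplace transform of M at |t|^alpha, that is
   1 / (1 + |t|^(alpha alpha')).
   For the uniqueness of the law with a given characteristic function, mix
   cos(t (c - k x)) over t >= 0 with weight e^(-t) to get the Cauchy kernel
   1 / (1 + (c - k x)^2), integrate over c to get atan(c - k x), and let
   k = N^2, c = N (N b - 1), N -> oo, to get pi 1_(x < b) - pi / 2. Each step
   preserves the equality of the expectations under two laws with the same
   characteristic function, so the laws agree on all rays. *)
From HB Require Import structures.
Require Import Defs.
From mathcomp Require Import all_boot all_order all_algebra.
From mathcomp Require Import complex ring lra.
From mathcomp Require Import all_classical all_reals all_analysis.
From mathcomp Require Import measurable_realfun.

Set Implicit Arguments.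
Unset Strict Implicit.
Unset Printing Implicit Defensive.

Import Order.TTheory GRing.Theory Num.Theory.
Import numFieldNormedType.Exports.

Local Open Scope classical_set_scope.
Local Open Scope ring_scope.

(** * Integrability, the fundamental theorem of calculus and Fubini *)

Lemma finite_bounded_integrable d (T : measurableType d) (R : realType)
    (m : {finite_measure set T -> \bar R}) (D : set T) (f : T -> R) (C : R) :
  measurable D -> measurable_fun D f -> (forall x, D x -> `|f x| <= C) ->
  m.-integrable D (EFin \o f).
Proof.
move=> mD mf fC; apply: measurable_bounded_integrable => //.
  by rewrite -ge0_fin_numE// fin_num_measure.
exists C; split; first exact: num_real.
by move=> y Cy x Dx; exact: le_trans (fC x Dx) (ltW Cy).
Qed.

Lemma Rintegral_FTC2 (R : realType) (f F : R -> R) (a b : R) : a < b ->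
  (forall x : R, is_derive x 1 F (f x)) -> continuous f ->
  \int[lebesgue_measure]_(x in `[a, b]) f x = F b - F a.
Proof.
move=> ab dF cf.
have cF x : {for x, continuous F}.
  by apply/differentiable_continuous/derivable1_diffP; case: (dF x).
rewrite /Rintegral (@continuous_FTC2 _ f F a b) ?EFinB//.
- exact: continuous_subspaceT.
- split; first by move=> x _; case: (dF x).
  + exact/cvg_at_right_filter/cF.
  + exact/cvg_at_left_filter/cF.
- by move=> x _; rewrite derive1E; case: (dF x).
Qed.

(** Fubini is applied on the full product space, with [D] entering through an indicator; the bound
    on [D] and the finite mass of [D] make the cut-off function integrable there. *)
Lemma Rintegral_Fubini_set d0 (T0 : measurableType d0) d (T : measurableType d)
    (R : realType) (mu : {sigma_finite_measure set T0 -> \bar R})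
    (m : probability T R) (g : T0 -> T -> R) (D : set T0) (C : R) :
  measurable D -> (mu D < +oo)%E ->
  measurable_fun setT (fun z : T0 * T => g z.1 z.2) ->
  (forall t x, D t -> `|g t x| <= C) ->
  \int[m]_x \int[mu]_(t in D) g t x = \int[mu]_(t in D) \int[m]_x g t x.
Proof.
move=> mD muD mg gC.
pose f (z : T0 * T) := (\1_D z.1 * g z.1 z.2)%:E.
have mf : measurable_fun setT f.
  apply/measurable_EFinP/measurable_funM => //.
  exact: (@measurableT_comp _ _ _ _ _ _ (\1_D : T0 -> R) _ fst
    (measurable_indic mD) measurable_fst).
have mgt t : measurable_fun setT (g t).
  exact: (measurableT_comp mg (pair1_measurable t)).
have mgx x : measurable_fun setT (g ^~ x).
  exact: (measurableT_comp mg (pair2_measurable x)).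
have it t : D t -> m.-integrable setT (EFin \o g t).
  move=> Dt; apply: (@finite_bounded_integrable _ _ _ _ _ _ C) => // x _.
  exact: gC.
have ix x : mu.-integrable D (EFin \o g ^~ x).
  apply: measurable_bounded_integrable => //; first exact: measurable_funTS.
  exists C; split; first exact: num_real.
  by move=> y Cy t Dt; exact: le_trans (gC t x Dt) (ltW Cy).
have intf : (mu \x m)%E.-integrable setT f.
  apply/integrable12ltyP => //.
  (* The sign of [C] is not assumed ([D] may be empty), so the dominating constant is its absolute
     value. *)
  apply: (@le_lt_trans _ _ (\int[mu]_(t in D) (cst `|C|%:E t))%E); last first.
    by rewrite integral_cst// lte_mul_pinfty// ?lee_fin.
  rewrite [leRHS]integral_mkcond; apply: ge0_le_integral => //.
  - by move=> t _; apply: integral_ge0.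
  - apply: (measurable_fun_fubini_tonelli_F (abse \o f)) => //=.
    exact: measurableT_comp.
  - by apply/measurable_restrict => //=; rewrite setTI; exact: measurable_cst.
  move=> t _; rewrite /f/= patchE indicE.
  have [tD|tD] := boolP (t \in D); last first.
    by rewrite integral0_eq// => x _; rewrite mul0r normr0.
  apply: (@le_trans _ _ (\int[m]_x (cst `|C|%:E x))%E).
    apply: ge0_le_integral => //=.
    - by do 2 apply: measurableT_comp => //; exact: measurable_funM.
    - move=> x _; rewrite mul1r lee_fin (le_trans _ (ler_norm C))// gC//.
      by rewrite inE in tD.
  rewrite integral_cst// -[leRHS]mule1; apply: lee_wpmul2l; rewrite ?lee_fin//.
  exact: probability_le1.
congr fine.
transitivity (\int[m]_x \int[mu]_t f (t, x))%E.
  apply: eq_integral => x _.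
  rewrite fineK; last exact: integrable_fin_num (ix x).
  rewrite integral_mkcond; apply: eq_integral => t _; rewrite /f patchE indicE.
  by case: ifPn; rewrite ?mul1r ?mul0r.
rewrite -Fubini//; rewrite [RHS]integral_mkcond; apply: eq_integral => t _.
rewrite /f patchE; case: ifPn => tD.
  rewrite inE in tD.
  rewrite fineK; last exact: integrable_fin_num (it t tD).
  by apply: eq_integral => x _; rewrite indicE mem_set// mul1r.
by rewrite integral0_eq// => x _; rewrite indicE (negbTE tD) mul0r.
Qed.

(** * Two explicit integrals over compact intervals *)

Lemma Rintegral_expRN_cos (R : realType) (u s : R) : 0 < s ->
  \int[lebesgue_measure]_(t in `[0, s]) (expR (- t) * cos (u * t)) =
  (1 + u ^+ 2)^-1 +
  expR (- s) * ((u * sin (u * s) - cos (u * s)) / (1 + u ^+ 2)).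
Proof.
move=> s0; have u1 : 1 + u ^+ 2 != 0 by rewrite gt_eqF// ltr_wpDr// sqr_ge0.
pose l : R -> R := u \*: id.
(* The real part of the primitive of e^(-(1 - i u) t). The endpoint 0 contributes the Cauchy kernel,
   the endpoint [s] a term of size e^(-s). *)
pose F : R -> R := (1 + u ^+ 2)^-1 \*:
  ((expR \o -%R) * (u \*: (sin \o l) - (cos \o l))).
have dF (t : R) : is_derive t 1 F (expR (- t) * cos (u * t)).
  apply: is_derive_eq.
  rewrite /GRing.scale/= /l /GRing.scale/= !fctE/= /GRing.scale/=.
  field.
  exact: u1.
have FE t : F t = (1 + u ^+ 2)^-1 *
    (expR (- t) * (u * sin (u * t) - cos (u * t))) by [].
rewrite (Rintegral_FTC2 s0 dF).
  rewrite !FE !mulr0 oppr0 expR0 sin0 cos0.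
  by field.
move=> t; apply: cvgM.
  by apply: continuous_comp; [exact: continuousN|exact: continuous_expR].
by apply: continuous_comp; [exact: mulrl_continuous|exact: continuous_cos].
Qed.

Lemma Rintegral_oneDsqrV_shift (R : realType) (a b c : R) : a < b ->
  \int[lebesgue_measure]_(t in `[a, b]) (1 + (t - c) ^+ 2)^-1 =
  atan (b - c) - atan (a - c).
Proof.
move=> ab; pose l : R -> R := id - cst c.
have dF (t : R) : is_derive t 1 (atan \o l) (1 + (t - c) ^+ 2)^-1.
  by apply: is_derive_eq; rewrite subr0 mulr1 /l !fctE.
rewrite (Rintegral_FTC2 ab dF)//.
move=> t; apply: (@continuous_comp _ _ _ (fun t => t - c)
  (fun t => (1 + t ^+ 2)^-1)).
  by apply: cvgB; [exact: cvg_id|exact: cvg_cst].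
exact: continuous_oneDsqrV.
Qed.

(** * Bounds, measurability and limits of the functions involved *)

Lemma normr_oneDsqrV_le1 (R : realType) (y : R) : `|(1 + y ^+ 2)^-1| <= 1.
Proof.
rewrite gtr0_norm ?invr_gt0 ?ltr_wpDr ?sqr_ge0//.
by rewrite invf_le1 ?lerDl ?sqr_ge0// ltr_wpDr ?sqr_ge0.
Qed.

Lemma normr_atan_le (R : realType) (x : R) : `|atan x| <= pi / 2.
Proof. by rewrite ler_norml !ltW ?atan_gtNpi2 ?atan_ltpi2. Qed.

Lemma measurable_cos (R : realType) : measurable_fun setT (@cos R).
Proof. exact: (continuous_measurable_fun (@continuous_cos R)). Qed.

Lemma measurable_sin (R : realType) : measurable_fun setT (@sin R).
Proof. exact: (continuous_measurable_fun (@continuous_sin R)). Qed.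

Lemma measurable_oneDsqrV (R : realType) :
  measurable_fun setT (fun x : R => (1 + x ^+ 2)^-1).
Proof. exact: (continuous_measurable_fun (@continuous_oneDsqrV R)). Qed.

Lemma measurable_atan (R : realType) : measurable_fun setT (@atan R).
Proof. by apply: continuous_measurable_fun => x; exact: continuous_atan. Qed.

Lemma cvg_atan_ge_nat (R : realType) (u : R^nat) :
  (\forall n \near \oo, n%:R <= u n) -> atan (u n) @[n --> \oo] --> pi / 2.
Proof.
move=> nu; apply: (@cvg_comp _ _ _ u (@atan R) _ _ _ _ (@cvgy_atan R)).
apply/cvgryPge => A; near=> n; apply: (@le_trans _ _ n%:R).
  by near: n; exact: nbhs_infty_ger.
by near: n.
Unshelve. all: end_near. Qed.

(** The numerator is at most |u| + 1 in absolute value, and 2 |u| <= 1 + u^2 because (|u| - 1)^2 >=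
    0. The bound is uniform in [u] and [s], so it serves both for domination and for the limit in
    [s]. *)
Lemma laplace_cos_remainder (R : realType) (u s : R) :
  `|(u * sin (u * s) - cos (u * s)) / (1 + u ^+ 2)| <= 2.
Proof.
have u1 : 0 < 1 + u ^+ 2 by rewrite ltr_wpDr// sqr_ge0.
rewrite normrM [`|_^-1|]gtr0_norm ?invr_gt0// ler_pdivrMr//.
rewrite (le_trans (ler_normB _ _))// normrM.
have := cos_max (u * s); have := sin_max (u * s).
have := sqr_ge0 (`|u| - 1); rewrite sqrrB real_normK ?num_real//.
have := normr_ge0 u; have := normr_ge0 (sin (u * s)).
nra.
Qed.

Lemma bounded_cvg_Rintegral d (T : measurableType d) (R : realType)
    (m : probability T R) (g_ : (T -> R)^nat) (g : T -> R) (C : R) :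
  (forall n, measurable_fun setT (g_ n)) ->
  (forall n x, `|g_ n x| <= C) ->
  (forall x, g_ n x @[n --> \oo] --> g x) ->
  \int[m]_x g_ n x @[n --> \oo] --> \int[m]_x g x.
Proof.
move=> mg gC gg.
have mlim : measurable_fun setT g.
  by apply: (measurable_fun_cvg mg) => x _; exact: gg.
have gleC x : `|g x| <= C.
  have cn : `|g_ n x| @[n --> \oo] --> `|g x| by apply: cvg_norm; exact: gg.
  rewrite -(cvg_lim (@Rhausdorff R) cn); apply: limr_le; last exact: nearW.
  exact: cvgP cn.
have ig : m.-integrable setT (EFin \o g).
  by apply: (@finite_bounded_integrable _ _ _ _ _ _ C).
apply: fine_cvg; rewrite fineK; last first.
  exact: (integrable_fin_num measurableT ig).
have [||||| _ _] // := @dominated_convergence _ _ _ m setT measurableT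
  (fun n x => (g_ n x)%:E) (EFin \o g) (cst C%:E).
- by move=> n; exact/measurable_EFinP.
- exact/measurable_EFinP.
- by apply: aeW => x _; apply: cvg_EFin; [exact: nearW|exact: gg].
- exact: finite_measure_integrable_cst.
- by apply: aeW => x n _; rewrite lee_fin.
Qed.

(** * Test functions with equal means under two laws *)

Section equal_char_integrals.
Context {R : realType} (m1 m2 : probability R R).

Definition same_mean (f : R -> R) := \int[m1]_x f x = \int[m2]_x f x.

(** Bounded convergence applies under each law; the two sequences of means coincide, hence so do
    their limits. *)
Lemma same_mean_cvg (g_ : (R -> R)^nat) (g : R -> R) (C : R) :
  (forall n, measurable_fun setT (g_ n)) ->
  (forall n x, `|g_ n x| <= C) ->
  (forall x, g_ n x @[n --> \oo] --> g x) ->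
  (forall n, same_mean (g_ n)) -> same_mean g.
Proof.
move=> mg gC gg same.
have c1 := bounded_cvg_Rintegral (m := m1) mg gC gg.
have c2 := bounded_cvg_Rintegral (m := m2) mg gC gg.
apply: (cvg_unique (@Rhausdorff R) c1).
rewrite (_ : (fun n => _) = (fun n => \int[m2]_x g_ n x))//.
by apply/funext => n; exact: same.
Qed.

(* Lebesgue measure lives on [measurableTypeR R], which carries the same
   sigma-algebra as [R] under a different display. *)
Lemma same_mean_mixture (g : R -> R -> R) (a b C : R) :
  measurable_fun setT (fun z : measurableTypeR R * R => g z.1 z.2) ->
  (forall t x, t \in `[a, b] -> `|g t x| <= C) ->
  (forall t, same_mean (g t)) ->
  same_mean (fun x => \int[lebesgue_measure]_(t in `[a, b]) g t x).
Proof.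
move=> mg gC same; rewrite /same_mean.
have fin : (@lebesgue_measure R `[a, b] < +oo)%E.
  by rewrite lebesgue_measure_itv/=; case: ifP => // _; rewrite ltry.
rewrite !(@Rintegral_Fubini_set _ _ _ _ _ _ _ _ _ C)//.
by apply: eq_Rintegral => t _; exact: same.
Qed.

Hypothesis same_cos : forall t, same_mean (fun x => cos (t * x)).
Hypothesis same_sin : forall t, same_mean (fun x => sin (t * x)).

Let bounded_int (m : probability R R) (f : R -> R) (C : R) :
  continuous f -> (forall x, `|f x| <= C) -> m.-integrable setT (EFin \o f).
Proof.
move=> cf fC; apply: (@finite_bounded_integrable _ _ _ _ _ _ C) => //.
exact: continuous_measurable_fun.
Qed.

(** The addition formula splits the integrand into cos(k t x) and sin(k t x) with coefficients free
    of x. Both the real and the imaginary part of the characteristic function enter here. *)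
Lemma same_mean_cos_affine (t k c : R) :
  same_mean (fun x => cos ((c - k * x) * t)).
Proof.
have ct : continuous ( *%R (k * t)) by exact: mulrl_continuous.
have ic (m : probability R R) :
    m.-integrable setT (EFin \o (fun x => cos (k * t * x))).
  apply: (@bounded_int _ _ 1) => x; last exact: cos_max.
  by apply: continuous_comp; [exact: ct|exact: continuous_cos].
have isn (m : probability R R) :
    m.-integrable setT (EFin \o (fun x => sin (k * t * x))).
  apply: (@bounded_int _ _ 1) => x; last exact: sin_max.
  by apply: continuous_comp; [exact: ct|exact: continuous_sin].
have E (m : probability R R) : \int[m]_x cos ((c - k * x) * t) =
    cos (c * t) * \int[m]_x cos (k * t * x) +
    sin (c * t) * \int[m]_x sin (k * t * x).
  rewrite -(RintegralZl _ measurableT (ic m)).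
  rewrite -(RintegralZl _ measurableT (isn m)).
  rewrite -(@RintegralD _ _ _ m)//.
  - by apply: eq_Rintegral => x _; rewrite mulrBl mulrAC cosB.
  - exact: (@integrableZl _ _ _ _ _ measurableT _ _ (ic m)).
  - exact: (@integrableZl _ _ _ _ _ measurableT _ _ (isn m)).
by rewrite /same_mean !E same_cos same_sin.
Qed.

(** By linearity it remains to treat constants, whose means agree because both laws have total mass
    1. *)
Lemma same_mean_affine (r c C : R) (f : R -> R) :
  measurable_fun setT f -> (forall x, `|f x| <= C) ->
  same_mean f -> same_mean (fun x => r * f x + c).
Proof.
move=> mf fC; rewrite /same_mean => same.
have intf (m : probability R R) : m.-integrable setT (EFin \o f).
  by apply: (@finite_bounded_integrable _ _ _ _ _ _ C).
have E (m : probability R R) :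
    \int[m]_x (r * f x + c) = r * \int[m]_x f x + c * fine (m setT).
  rewrite -(RintegralZl _ measurableT (intf m)) -(Rintegral_cst m)//.
  rewrite -(@RintegralD _ _ _ m)//.
  - exact: (@integrableZl _ _ _ _ _ measurableT _ _ (intf m)).
  - exact: finite_measure_integrable_cst.
by rewrite !E same !probability_setT.
Qed.

(** The kernel is the limit of the integrals of e^(-t) cos((c - k x) t) over [0, n + 1], each a
    mixture of cosines. *)
Lemma same_mean_cauchy (k c : R) :
  same_mean (fun x => (1 + (c - k * x) ^+ 2)^-1).
Proof.
(* The factor of e^(-(n + 1)) in the closed form of the truncated integral; n + 1 keeps the interval
   nondegenerate at n = 0. *)
pose rem n x := ((c - k * x) * sin ((c - k * x) * n.+1%:R)
  - cos ((c - k * x) * n.+1%:R)) / (1 + (c - k * x) ^+ 2).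
pose h n x := (1 + (c - k * x) ^+ 2)^-1 + expR (- n.+1%:R) * rem n x.
have hE n x : h n x = \int[lebesgue_measure]_(t in `[0, n.+1%:R])
   (expR (- t) * cos ((c - k * x) * t)).
  by rewrite Rintegral_expRN_cos.
have r2 n x : `|rem n x| <= 2 by exact: laplace_cos_remainder.
have cu : continuous (fun x => c - k * x).
  move=> x; apply: cvgB; first exact: cvg_cst.
  exact: mulrl_continuous.
have mu : measurable_fun setT (fun x => c - k * x).
  exact: continuous_measurable_fun.
have mV : measurable_fun setT (fun x => (1 + (c - k * x) ^+ 2)^-1).
  exact: (measurableT_comp (@measurable_oneDsqrV R)).
(* The kernel is bounded by 1 and the remainder by 2, its exponential factor being at most 1. *)
apply: (@same_mean_cvg h _ (1 + 2)).
- move=> n; rewrite /h /rem.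
  have ms : measurable_fun setT (fun x => (c - k * x) * n.+1%:R).
    exact: measurable_funM.
  apply: measurable_funD => //; apply: measurable_funM => //.
  apply: measurable_funM => //; apply: measurable_funB.
    apply: measurable_funM => //.
    exact: (measurableT_comp (@measurable_sin R)).
  exact: (measurableT_comp (@measurable_cos R)).
- move=> n x; rewrite /h (le_trans (ler_normD _ _))// lerD//.
    exact: normr_oneDsqrV_le1.
  rewrite normrM gtr0_norm ?expR_gt0//.
  by rewrite -[leRHS]mul1r ler_pM ?expR_ge0.
- move=> x; rewrite -[X in _ --> X]addr0; apply: cvgD; first exact: cvg_cst.
  have e0 : expR (- n.+1%:R) @[n --> \oo] --> (0 : R).
    by rewrite (cvg_shiftS (fun n => expR (- n%:R))); exact: cvgn_expR.
  apply: (@squeeze_cvgr _ _ _ _ (fun n => - (expR (- n.+1%:R) * 2))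
      (fun n => expR (- n.+1%:R) * 2)).
  + apply: nearW => n; rewrite -ler_norml normrM gtr0_norm ?expR_gt0//.
    by rewrite ler_pM2l ?expR_gt0.
  + by rewrite -oppr0 -(mul0r 2); apply: cvgN; apply: cvgMl.
  + by rewrite -(mul0r 2); apply: cvgMl.
- move=> n.
  rewrite (_ : h n = fun x => \int[lebesgue_measure]_(t in `[0, n.+1%:R])
    (expR (- t) * cos ((c - k * x) * t))); last exact/funext/hE.
  apply: (@same_mean_mixture
    (fun t x => expR (- t) * cos ((c - k * x) * t)) _ _ 1).
  + have mfst : measurable_fun setT
        (fun z : measurableTypeR R * R => z.1 : R).
      by move=> _ Y mY; exact: measurable_fst.
    apply: measurable_funM.
      apply: (measurableT_comp (@measurable_expR R)).
      exact: measurable_funN.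
    apply: (measurableT_comp (@measurable_cos R)).
    apply: measurable_funM => //.
    exact: (measurableT_comp mu measurable_snd).
  + move=> t x; rewrite in_itv/= => /andP[t0 _].
    rewrite normrM gtr0_norm ?expR_gt0// mulr_ile1 ?expR_ge0//.
    * by rewrite -[leRHS]expR0 ler_expR oppr_le0.
    * exact: cos_max.
  + move=> t.
    (* Adding 0 gives the multiple of a cosine the affine form [r * f x + c]. *)
    rewrite (_ : (fun x => _) =
        (fun x => expR (- t) * cos ((c - k * x) * t) + 0)); last first.
      by apply/funext => x; rewrite addr0.
    apply: (@same_mean_affine _ _ 1) (same_mean_cos_affine t k c).
      apply: (measurableT_comp (@measurable_cos R)).
      exact: measurable_funM.
    by move=> x; exact: cos_max.
Qed.

(** Integrating the Cauchy kernel over its shift in [c - n - 1, c] and letting n grow gives the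
    arctangent plus pi / 2; the constant is removed at the end. *)
Lemma same_mean_atan (k c : R) : same_mean (fun x => atan (c - k * x)).
Proof.
have ma b : measurable_fun setT (fun x => atan (b - k * x)).
  apply: (measurableT_comp (@measurable_atan R)).
  by apply: measurable_funB => //; exact: measurable_funM.
pose h n x := atan (c - k * x) - atan (c - n.+1%:R - k * x).
have hE n x : h n x = \int[lebesgue_measure]_(t in `[c - n.+1%:R, c])
    (1 + (t - k * x) ^+ 2)^-1.
  by rewrite Rintegral_oneDsqrV_shift// ltrBlDr ltrDl.
have same : same_mean (fun x => atan (c - k * x) + pi / 2).
  apply: (@same_mean_cvg h _ (pi / 2 + pi / 2)).
  - by move=> n; apply: measurable_funB.
  - by move=> n x; rewrite (le_trans (ler_normB _ _))// lerD ?normr_atan_le.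
  - move=> x; apply: cvgD; first exact: cvg_cst.
    (* By oddness, minus the arctangent from the lower endpoint is an arctangent whose argument
       tends to +oo. *)
    rewrite (_ : (fun n => _) =
        (fun n => atan (k * x - c + n.+1%:R))); last first.
      by apply/funext => n; rewrite -atanN; congr atan; ring.
    apply: (@cvg_comp _ _ _ (fun n => k * x - c + n.+1%:R) (@atan R)
      _ _ _ _ (@cvgy_atan R)).
    apply/cvgryPge => A; near=> n; rewrite -lerBlDl (@le_trans _ _ n%:R)//.
      by near: n; exact: nbhs_infty_ger.
    by rewrite ler_nat.
  - move=> n; rewrite (_ : h n = fun x =>
      \int[lebesgue_measure]_(t in `[c - n.+1%:R, c])
        (1 + (t - k * x) ^+ 2)^-1);
      last exact/funext/hE.
    apply: (@same_mean_mixture (fun t x => (1 + (t - k * x) ^+ 2)^-1) _ _ 1).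
    + have mfst : measurable_fun setT
          (fun z : measurableTypeR R * R => z.1 : R).
        by move=> _ Y mY; exact: measurable_fst.
      apply: (measurableT_comp (@measurable_oneDsqrV R)).
      apply: measurable_funB; first exact: mfst.
      by apply: measurable_funM => //; exact: measurable_snd.
    + by move=> t x _; exact: (normr_oneDsqrV_le1).
    + by move=> t; exact: same_mean_cauchy.
rewrite (_ : (fun x => _) =
    (fun x => 1 * (atan (c - k * x) + pi / 2) + - (pi / 2))); last first.
  by apply/funext => x; rewrite mul1r addrK.
apply: (@same_mean_affine _ _ (pi / 2 + pi / 2)) same.
  by apply: measurable_funD.
move=> x; rewrite (le_trans (ler_normD _ _))// lerD ?normr_atan_le//.
by rewrite ger0_norm// divr_ge0// pi_ge0.
Unshelve. all: end_near. Qed.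

(** With N = n + 1 the argument is N (N (b - x) - 1). The -1 settles the point x = b, where the
    argument is -N, so the limit is the indicator of the open ray at every point and atoms at [b]
    cause no trouble. *)
Lemma same_mean_ray (b : R) : same_mean \1_`]-oo, b[.
Proof.
pose h n (x : R) := atan (n.+1%:R * (n.+1%:R * b - 1) - n.+1%:R ^+ 2 * x).
have hE n x : h n x = atan (n.+1%:R * (n.+1%:R * (b - x) - 1)).
  by rewrite /h; congr atan; ring.
have same : same_mean (fun x => pi * \1_`]-oo, b[ x + - (pi / 2)).
  apply: (@same_mean_cvg h _ (pi / 2)).
  - move=> n; apply: (measurableT_comp (@measurable_atan R)).
    by apply: measurable_funB => //; exact: measurable_funM.
  - by move=> n x; exact: normr_atan_le.
  - move=> x; under eq_fun do rewrite hE.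
    rewrite indicE mem_setE in_itv/=; case: ltP => xb /=.
      rewrite (_ : _ + _ = pi / 2); last by lra.
      apply: cvg_atan_ge_nat; near=> n.
      (* From n >= 2 / (b - x) on, N (b - x) - 1 is at least 1, so the argument is at least N. *)
      have : (b - x)^-1 * 2 <= n%:R by near: n; exact: nbhs_infty_ger.
      rewrite ler_pdivrMl ?subr_gt0// => h2.
      by rewrite -natr1; have := ler0n R n; nra.
    (* For x >= b the factor N (b - x) - 1 is at most -1; oddness turns this into a limit at +oo. *)
    rewrite (_ : _ + _ = - (pi / 2)); last by lra.
    under eq_fun do rewrite -[X in atan X]opprK atanN.
    apply: cvgN; apply: cvg_atan_ge_nat; apply: nearW => n.
    by rewrite -natr1; have := ler0n R n; nra.
  - by move=> n; exact: same_mean_atan.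
(* The inverse affine map recovers the indicator from the limit. *)
rewrite (_ : \1_`]-oo, b[ = fun x =>
    pi^-1 * (pi * \1_`]-oo, b[ x + - (pi / 2)) + 2^-1); last first.
  apply/funext => x; rewrite mulrDr mulrN !mulrA mulVf ?gt_eqF ?pi_gt0//.
  by rewrite !mul1r subrK.
apply: (@same_mean_affine _ _ (pi + pi / 2)) same.
  by apply: measurable_funD => //; apply: measurable_funM => //;
    exact: measurable_indic.
move=> x; rewrite (le_trans (ler_normD _ _))// normrN normrM.
rewrite lerD//; last by rewrite ger0_norm// divr_ge0// pi_ge0.
rewrite ger0_norm ?pi_ge0// -[leRHS]mulr1 ler_pM ?pi_ge0// indicE.
by case: (_ \in _); rewrite ?normr1 ?normr0.
Unshelve. all: end_near. Qed.

End equal_char_integrals.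

(** * Uniqueness of the law with a given characteristic function *)

Section char_fun.
Context {R : realType}.

(** Open left rays are stable under intersection and generate the Borel sets, and those ending at
    natural numbers exhaust the line with finite mass; agreement on rays therefore extends to all
    Borel sets. *)
Lemma char_integrals_measure_unique (m1 m2 : probability R R) :
  (forall t, \int[m1]_x cos (t * x) = \int[m2]_x cos (t * x)) ->
  (forall t, \int[m1]_x sin (t * x) = \int[m2]_x sin (t * x)) ->
  forall A, measurable A -> m1 A = m2 A.
Proof.
move=> same_cos same_sin A mA.
apply: (measure_unique (@RGenInftyO.G R) (fun k => `]-oo, k%:R[%classic)) => //.
- exact: RGenInftyO.measurableE.
- move=> _ _ [x ->] [y ->]; exists (Num.min x y).
  by apply/seteqP; split => z /=; rewrite !in_itv/= lt_min => /andP.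
- by move=> i; exists i%:R.
- rewrite -subTset => x _; exists (Num.truncn x).+1 => //=.
  by rewrite in_itv/= truncnS_gt.
- move=> _ [b ->]; have := same_mean_ray same_cos same_sin b.
  rewrite /same_mean /Rintegral !integral_indic ?setIT//.
  by move=> h; rewrite -[LHS]fineK ?fin_num_measure// h fineK ?fin_num_measure.
- by move=> k; rewrite -ge0_fin_numE// fin_num_measure.
Qed.

Lemma Rintegral_distribution d d' (T : measurableType d)
    (T' : measurableType d') (P : probability T R) (X : {mfun T >-> T'})
    (f : T' -> R) (C : R) :
  measurable_fun setT f -> (forall x, `|f x| <= C) ->
  \int[distribution P X]_x f x = \int[P]_w f (X w).
Proof.
move=> mf fC; congr fine; rewrite integral_distribution//.
  exact/measurable_EFinP.
apply: (@finite_bounded_integrable _ _ _ _ _ _ C) => //.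
exact: measurableT_comp.
Qed.

Lemma measurable_cosM (t : R) : measurable_fun setT (fun x => cos (t * x)).
Proof.
apply: (measurableT_comp (@measurable_cos R)).
exact: measurable_funM.
Qed.

Lemma measurable_sinM (t : R) : measurable_fun setT (fun x => sin (t * x)).
Proof.
apply: (measurableT_comp (@measurable_sin R)).
exact: measurable_funM.
Qed.

Lemma char_funE d (T : measurableType d) (P : probability T R)
    (X : {RV P >-> R}) (t : R) :
  char_fun P X t = Complex (\int[distribution P X]_x cos (t * x))
                           (\int[distribution P X]_x sin (t * x)).
Proof.
rewrite (Rintegral_distribution P X (measurable_cosM t)
  (fun x => cos_max (t * x))).
rewrite (Rintegral_distribution P X (measurable_sinM t)
  (fun x => sin_max (t * x))).
by rewrite /char_fun unlock.
Qed.

Lemma char_fun_inj d1 d2 (T1 : measurableType d1) (T2 : measurableType d2)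
    (P1 : probability T1 R) (P2 : probability T2 R)
    (X : {RV P1 >-> R}) (Y : {RV P2 >-> R}) :
  char_fun P1 X =1 char_fun P2 Y -> eq_in_distribution P1 P2 X Y.
Proof.
move=> XY; apply: char_integrals_measure_unique => t;
  by move: (XY t); rewrite !char_funE => -[].
Qed.

End char_fun.

(** * Joint laws of independent variables *)

Section independence.
Context d {T : measurableType d} {R : realType} (P : probability T R).
Variables X Y : {RV P >-> R}.

Definition pair_RV (w : T) : R * R := (X w, Y w).

Let measurable_pair_RV : measurable_fun setT pair_RV.
Proof. by apply: measurable_fun_pair; exact: measurable_funP. Qed.

HB.instance Definition _ :=
  isMeasurableFun.Build _ _ _ _ pair_RV measurable_pair_RV.

(** Independence makes the joint law agree with the product of the marginals on rectangles, which
    determines it; Fubini then puts the integral over [X] inside. *)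
Lemma independent_Rintegral (f : R -> R -> R) (C : R) :
  independent_RV P X Y -> measurable_fun setT (fun z : R * R => f z.1 z.2) ->
  (forall x y, `|f x y| <= C) ->
  \int[P]_w f (X w) (Y w) =
  \int[distribution P Y]_y \int[distribution P X]_x f x y.
Proof.
move=> indep mf fC.
rewrite -(@Rintegral_distribution _ _ _ _ _ P pair_RV (fun z => f z.1 z.2) C)//.
have joint : \int[distribution P pair_RV]_z f z.1 z.2 =
    fine (\int[(distribution P X \x distribution P Y)]_z (f z.1 z.2)%:E)%E.
  congr fine; apply: eq_measure_integral => A mA _.
  exact/esym/product_measure_unique.
rewrite joint /Rintegral -integral21_prod_meas1; last first.
  (* Seen as a probability, the product is a finite measure, so boundedness gives integrability. *)
  pose PXY : probability (R * R)%type R :=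
    (distribution P X \x distribution P Y)%E.
  exact: (@finite_bounded_integrable _ _ _ PXY _ (fun z => f z.1 z.2) C).
congr fine; apply: eq_integral => y _; rewrite fineK//.
apply: (@integrable_fin_num _ _ _ _ _ measurableT (EFin \o f^~ y)).
apply: (@finite_bounded_integrable _ _ _ _ _ _ C) => //.
exact: (measurableT_comp mf (pair2_measurable y)).
Qed.

End independence.

(** * Characteristic function of the product and the conclusion *)

Lemma powR_norm_mul_root (R : realType) (alpha t m : R) :
  0 < alpha -> 0 <= m -> `|t * m `^ alpha^-1| `^ alpha = `|t| `^ alpha * m.
Proof.
move=> a0 m0; rewrite normrM [`|_ `^ _|]ger0_norm ?powR_ge0// powRM ?powR_ge0//.
by rewrite -powRrM mulVf ?gt_eqF// powRr1.
Qed.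

(** For fixed Y = y, t (x y) = (t y) x, so the inner integral over [X] is its characteristic
    function at t y. *)
Lemma char_fun_mul_independent (R : realType) d (T : measurableType d)
    (P : probability T R) (X Y : {RV P >-> R}) (t : R) :
  independent_RV P X Y ->
  char_fun P (mul_RV P X Y) t =
  Complex (\int[distribution P Y]_y complex.Re (char_fun P X (t * y)))
          (\int[distribution P Y]_y complex.Im (char_fun P X (t * y))).
Proof.
move=> XY; rewrite [LHS]/char_fun unlock.
have mtz : measurable_fun setT (fun z : R * R => t * (z.1 * z.2)).
  apply: measurable_funM => //; apply: measurable_funM.
    exact: measurable_fst.
  exact: measurable_snd.
have ec := @independent_Rintegral _ _ _ P X Y
  (fun x y => cos (t * (x * y))) 1 XY
  (measurableT_comp (@measurable_cos R) mtz)
  (fun x y => cos_max _).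
have es := @independent_Rintegral _ _ _ P X Y
  (fun x y => sin (t * (x * y))) 1 XY
  (measurableT_comp (@measurable_sin R) mtz)
  (fun x y => sin_max _).
congr Complex.
  rewrite [LHS]ec; apply: eq_Rintegral => y _; rewrite char_funE/=.
  by apply: eq_Rintegral => x _; congr cos; ring.
rewrite [LHS]es; apply: eq_Rintegral => y _; rewrite char_funE/=.
by apply: eq_Rintegral => x _; congr sin; ring.
Qed.

Lemma char_fun_stable_mul_root (R : realType) (alpha delta : R)
    d (T : measurableType d) (P : probability T R) (S M : {RV P >-> R})
    (t : R) :
  0 < alpha -> independent_RV P S M -> symmetric_stable P alpha S ->
  mittag_leffler P delta M ->
  char_fun P (mul_RV P S (powR_RV P M alpha^-1)) t =
  ((1 + `|t| `^ (alpha * delta))^-1)%:C%C.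
Proof.
move=> a0 SM hS [M0 hM].
rewrite char_fun_mul_independent; last first.
  (* Independence passes from [M] to its root, since the preimage of a Borel set under the root is
     Borel. *)
  move=> A B mA mB.
  have mB' : measurable (@powR R ^~ alpha^-1 @^-1` B).
    by rewrite -[_ @^-1` _]setTI; exact: measurable_powR.
  exact: (SM A _ mA mB').
set m := distribution _ _.
rewrite (_ : \int[m]_y _ = (1 + `|t| `^ (alpha * delta))^-1); last first.
  under eq_Rintegral do rewrite hS /=.
  have mp : measurable_fun setT (fun y => expR (- (`|t * y| `^ alpha))).
    apply: (measurableT_comp (@measurable_expR R)).
    apply: measurable_funN; apply: (measurableT_comp (measurable_powR alpha)).
    by apply: measurableT_comp => //; exact: measurable_funM.
  rewrite (@Rintegral_distribution _ _ _ _ _ P (powR_RV P M alpha^-1) _ 1 mp);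
    last first.
    by move=> y; rewrite gtr0_norm ?expR_gt0// -[leRHS]expR0 ler_expR
      oppr_le0 powR_ge0.
  have := hM (`|t| `^ alpha) (powR_ge0 _ _).
  rewrite unlock -powRrM => hMt.
  transitivity (fine ((1 + `|t| `^ (alpha * delta))^-1)%:E) => //.
  rewrite -hMt; congr fine.
  (* Where [M] is negative its root is a default value, so the integrands are only compared almost
     everywhere; that event is null by the definition of the Mittag-Leffler law. *)
  apply: ae_eq_integral => //.
  - by apply/measurable_EFinP; apply: (measurableT_comp mp).
  - apply/measurable_EFinP.
    apply: (measurableT_comp (@measurable_expR R)).
    by apply: measurable_funN; exact: measurable_funM.
  exists [set w | M w < 0]; split => //.
    have := measurable_funPTI M (measurable_itv `]-oo, (0 : R)[).
    by congr (measurable _); apply/seteqP; split => w; rewrite /= in_itv.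
  move=> w /= h; rewrite ltNge; apply/negP => Mw; apply: h => _.
  by rewrite powR_norm_mul_root.
(* The characteristic function of [S] is real, so the imaginary part is the integral of 0. *)
rewrite (_ : \int[m]_y _ = 0)//; under eq_Rintegral do rewrite hS /=.
by rewrite Rintegral_cst// mul0r.
Qed.

Theorem theorem1 (R : realType) (alpha alpha' : R)
  (halpha : 0 < alpha <= 2) (halpha' : 0 < alpha' <= 1)
  (d1 : measure_display) (T1 : measurableType d1) (P1 : probability T1 R)
  (L : {RV P1 >-> R})
  (hL : linnik P1 (alpha * alpha') L)
  (d2 : measure_display) (T2 : measurableType d2) (P2 : probability T2 R)
  (S M : {RV P2 >-> R})
  (hSM : independent_RV P2 S M)
  (hS : symmetric_stable P2 alpha S)
  (hM : mittag_leffler P2 alpha' M) :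
  eq_in_distribution P1 P2 L (mul_RV P2 S (powR_RV P2 M alpha^-1)).
Proof.
have [a0 _] := andP halpha.
apply: char_fun_inj => t.
by rewrite hL (char_fun_stable_mul_root t a0 hSM hS hM).
Qed.
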